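(* Let $\mathcal{F}$ be a non-meager $P$-filter on $\omega$ extending the Fréchet filter. Then both $\mathcal{F}$ and the countably infinite power ${}^{\omega}\mathcal{F}$ are countable dense homogeneous.
   Context: $\mathcal{P}(\omega)$ is the power set of $\omega$, identified via characteristic functions with the Cantor set ${}^{\omega}2$ (product topology, $2=\{0,1\}$ discrete). Every subset of $\mathcal{P}(\omega)$ carries the subspace topology, so it is a separable metrizable space. A filter (on $\omega$) is a set $\mathcal{F}\subset\mathcal{P}(\omega)$ such that (a) $\omega\in\mathcal{F}$ and $\emptyset\notin\mathcal{F}$; (b) if $A,B\in\mathcal{F}$ then $A\cap B\in\mathcal{F}$; (c) if $A\in\mathcal{F}$ and $A\subset B\subset\omega$ then $B\in\mathcal{F}$. The Fréchet filter is $\{x\subset\omega:\omega\setminus x\text{ is finite}\}$. For sets $A,B$, $A\subset^{*}B$ means that $A\setminus B$ is finite. A filter $\mathcal{F}$ is a $P$-filter if for every $\{X_n:n<\omega\}\subset\mathcal{F}$ there exists $X\in\mathcal{F}$ such that $X\subset^{*}X_n$ for all $n<\omega$. ''Non-meager'' means non-meager as a subset of the Cantor set $\mathcal{P}(\omega)$. The space ${}^{\omega}\mathcal{F}$ is the product of countably infinitely many copies of $\mathcal{F}$ with the product topology. A separable space $X$ is countable dense homogeneous if whenever $D$ and $E$ are countable dense subsets of $X$, there exists a homeomorphism $h:X\to X$ such that $h[D]=E$. *)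

(* Defs.v *)
From HB Require Import structures.
From mathcomp Require Import all_boot.
From mathcomp Require Import boolp classical_sets functions cardinality filter.
From mathcomp Require Import topology cantor.

Set Implicit Arguments.
Unset Strict Implicit.
Unset Printing Implicit Defensive.

Local Open Scope classical_set_scope.

Section Topology.
Context {T : topologicalType}.

Definition nowhere_dense (A : set T) : Prop := interior (closure A) = set0.

Definition meager (A : set T) : Prop :=
  exists2 G : nat -> set T,
    (forall n, nowhere_dense (G n)) & A `<=` \bigcup_n G n.

Definition homeomorphism (h : T -> T) : Prop :=
  exists g : T -> T,
    [/\ cancel h g, cancel g h, continuous h & continuous g].

End Topology.

Definition separable (T : topologicalType) : Prop :=
  exists2 D : set T, countable D & dense D.

Definition countable_dense_homogeneous (T : topologicalType) : Prop :=
  separable T /\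
  forall D E : set T, countable D -> dense D -> countable E -> dense E ->
    exists2 h : T -> T, homeomorphism h & h @` D = E.

Definition frechet : set_system nat := [set x | finite_set (~` x)].

Definition almost_subset (A B : set nat) : Prop := finite_set (A `\` B).

(* The filter axioms themselves are the library's [ProperFilter]. *)
Definition P_filter (F : set_system nat) : Prop :=
  ProperFilter F /\
  forall X : nat -> set nat, (forall n, F (X n)) ->
    exists2 Y : set nat, F Y & forall n, almost_subset Y (X n).

(* The image of [F] under the identification of a subset of [nat] with its
   characteristic function. *)
Definition cantor_of (F : set_system nat) : set cantor_space :=
  [set x : cantor_space | F [set n | x n]].

(* [F] with the topology inherited from the Cantor set; the topology on
   [set_type] is the initial topology of the inclusion. *)
Definition filter_space (F : set_system nat) : topologicalType :=
  set_type (cantor_of F).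

Definition filter_power (F : set_system nat) : topologicalType :=
  prod_topology (fun _ : nat => filter_space F).

(* Main.v *)
Require Import Defs.
From mathcomp Require Import all_boot.
From mathcomp Require Import boolp classical_sets functions cardinality filter.
From mathcomp Require Import topology cantor.

(** Let [D] and [E] be countable dense subsets of [F].  The homeomorphism of
[F] carrying [D] to [E] is the restriction of an isometry of the Cantor set
that leaves unchanged the coordinates in a suitable set [N] of the filter.
Such an isometry preserves [F], because a point and its image agree on [N].

The set [N] has to make [D] and [E] interchangeable over it: every [d] in [D]
must have, in every cylinder compatible with the values of [d] on [N], a point
of [E] with the same restriction to [N] ([fiber_dense]), and symmetrically.
Given this, a back-and-forth construction matches [D] with [E] by a bijection
that preserves the length of common prefixes and the values on [N]
([back_and_forth]).  A relation of this kind between binary sequences extends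
canonically to an isometry of the whole Cantor set: to compute the [k]-th bit
of the image of [x], find a matched point with the same first [k] bits as [x]
and flip the bit exactly when the match does ([extension]).

To find [N], choose for every finite word [u] a point of [D] and a point of
[E] beginning with [u], and let [G m] be the intersection of those chosen for
words of length [m] and of the first [m + 1] points of [D] and of [E]; it
belongs to [F].  Suppose that [N] in [F] satisfies [N `\` `I_m `<=` G m] for
infinitely many [m].  Then, for such an [m], all the points involved in [G m]
take the value [true] on [N] beyond [m], so they agree there, and below [m] the
word can be prescribed at will: this gives [fiber_dense].

A non-meager P-filter has such a set [N] for every sequence [G]
([P_filter_diagonalizable]): take a pseudo-intersection [Y] of the [G m], cut
the natural numbers into blocks so long that [Y] is contained in [G m] beyond
the block that begins at [m], and intersect [Y] with a set of [F] that misses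
infinitely many blocks.  That set exists because the sets meeting all but
finitely many blocks form a meager family.

A bijection between pairs of natural numbers and natural numbers identifies
the countable power of [F] with the space of the filter of those subsets of
the plane all of whose vertical sections belong to [F].  This filter contains
the cofinite sets and inherits the diagonal property
([diagonalizable_power]), so the same argument applies to it. *)

Local Open Scope classical_set_scope.

Set Implicit Arguments.
Unset Strict Implicit.
Unset Printing Implicit Defensive.

(** * Agreement of binary sequences and partial isometries *)

Definition agree (m : nat) (x y : nat -> bool) : Prop :=
  forall i, i < m -> x i = y i.

Lemma agree_sym m x y : agree m x y -> agree m y x.
Proof. by move=> xy i im; rewrite xy. Qed.

Lemma agree_trans m y x z : agree m x y -> agree m y z -> agree m x z.
Proof. by move=> xy yz i im; rewrite xy // yz. Qed.

Lemma agree_le m n x y : m <= n -> agree n x y -> agree m x y.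
Proof. by move=> mn xy i im; apply: xy; exact: leq_trans mn. Qed.

Lemma agreeS m x y : agree m x y -> x m = y m -> agree m.+1 x y.
Proof.
by move=> xy xym i; rewrite ltnS leq_eqVlt => /predU1P[->//|]; exact: xy.
Qed.

Lemma agree_neq x y : x <> y -> exists m, ~ agree m x y.
Proof.
move=> xy; apply: contrapT => /forallNP h; apply: xy; apply/funext => k.
by move/contrapT: (h k.+1); exact.
Qed.

Local Notation relation := (set ((nat -> bool) * (nat -> bool))).

Definition isometric (R : relation) : Prop :=
  forall p q, R p -> R q -> forall m, agree m p.1 q.1 <-> agree m p.2 q.2.

Definition converse (R : relation) : relation := [set p | R (p.2, p.1)].

(** Two points of the domain of an isometric [R] that agree with [x] below [k] are
either both flipped at [k] or both not flipped there, because the space is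
binary; so any witness decides. *)
Definition flip (R : relation) (x : nat -> bool) (k : nat) : bool :=
  `[< exists2 p, R p & agree k p.1 x /\ p.1 k != p.2 k >].

Definition extension (R : relation) (x : nat -> bool) : nat -> bool :=
  fun k => x k (+) flip R x k.

Lemma isometric_converse R : isometric R -> isometric (converse R).
Proof. by move=> iR p q Rp Rq m; rewrite (iR _ _ Rp Rq m). Qed.

Lemma flip_agree R k x y : agree k x y -> flip R x k = flip R y k.
Proof.
move=> xy; apply/asboolP/asboolP => -[p Rp [px pk]]; exists p => //; split=> //.
  exact: agree_trans px xy.
exact: agree_trans px (agree_sym xy).
Qed.

Lemma extension_agree R m x y :
  agree m (extension R x) (extension R y) <-> agree m x y.
Proof.
split=> [|xy i im]; last first.
  rewrite /extension xy // (@flip_agree R i x y) //.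
  by apply: agree_le xy; exact: ltnW.
elim: m => [|m IH] // hxy; have xy := IH (agree_le (leqnSn m) hxy).
apply: agreeS => //; have := hxy m (ltnSn m).
by rewrite /extension (@flip_agree R m x y) // => /addIb.
Qed.

(** If another point [q] of [R] agreed with [p] below [k] and were flipped at [k]
while [p] was not, then exactly one of the pairs of first and of second
components would still agree at [k], against the isometry of [R]. *)
Lemma extension_graph R p : isometric R -> R p -> extension R p.1 = p.2.
Proof.
move=> iR Rp; apply/funext => k; rewrite /extension.
suff -> : flip R p.1 k = (p.1 k != p.2 k) by case: (p.1 k); case: (p.2 k).
apply/asboolP/idP => [[q Rq [qp1 qk]]|pk]; last by exists p.
apply/negP => /eqP pk; have qp2 := (iR _ _ Rq Rp k).1 qp1.
have [q1p1|q1p1] := eqVneq (q.1 k) (p.1 k).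
  have /(_ k (ltnSn k)) q2p2 := (iR _ _ Rq Rp k.+1).1 (agreeS qp1 q1p1).
  by move: qk; rewrite q1p1 q2p2 pk eqxx.
have q2p2 : q.2 k = p.2 k.
  by move: qk q1p1; rewrite pk; case: (q.1 k); case: (q.2 k); case: (p.2 k).
have /(_ k (ltnSn k)) := (iR _ _ Rq Rp k.+1).2 (agreeS qp2 q2p2).
by move/eqP; rewrite (negPf q1p1).
Qed.

(** The extensions of [R] and of its converse flip the same bits: [p.1] and [x] have
the same common prefix as their images [p.2] and [extension R x]. *)
Lemma extensionK R : isometric R ->
  cancel (extension R) (extension (converse R)).
Proof.
move=> iR x; apply/funext => k; rewrite /extension.
suff -> : flip (converse R) (extension R x) k = flip R x k.
  by rewrite -addbA addbb addbF.
apply/asboolP/asboolP => -[p Rp [pk pk']]; last first.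
  exists (p.2, p.1); first by move: Rp; rewrite /converse /= -surjective_pairing.
  split=> /=; last by rewrite eq_sym.
  by rewrite -(extension_graph iR Rp) extension_agree.
exists (p.2, p.1) => //; split=> /=; last by rewrite eq_sym.
move: pk; have /= <- := extension_graph iR Rp.
by rewrite extension_agree.
Qed.

Lemma converseK R : converse (converse R) = R.
Proof. by apply/seteqP; split=> -[x y]. Qed.

Lemma extension_fix R x k :
  (forall p, R p -> p.1 k = p.2 k) -> extension R x k = x k.
Proof.
move=> Rk; rewrite /extension; suff -> : flip R x k = false by rewrite addbF.
by apply/asboolP => -[p /Rk ->]; rewrite eqxx => -[].
Qed.

(** * Back and forth *)

Lemma finite_set_bounded (T : Type) (A : set T) (f : T -> nat) :
  finite_set A -> exists b, forall x, A x -> f x < b.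
Proof.
move=> /(finite_image f)/finite_fsetP[X AX].
exists (\max_(i <- finmap.enum_fset X) i).+1 => x Ax; rewrite ltnS.
apply: (@leq_bigmax_seq _ _ predT id) => //.
have : (f @` A) (f x) by exists x.
by rewrite AX.
Qed.

(** Points are matched inside the fibers of the restriction map to [N]. *)
Definition fiberwise_isometry (N : set nat) (D E : set (nat -> bool))
    (R : relation) : Prop :=
  [/\ isometric R, forall p, R p -> D p.1 /\ E p.2
    & forall p k, R p -> N k -> p.1 k = p.2 k].

Lemma fiberwise_isometry_converse N D E R :
  fiberwise_isometry N D E R -> fiberwise_isometry N E D (converse R).
Proof.
case=> iR DE fixR; split=> [|p /DE[]//|p k Rp Nk]; first exact: isometric_converse.
by have /= -> := fixR _ _ Rp Nk.
Qed.

(** In every fiber of the restriction map to [N] that meets [D], the set [E] is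
dense. *)
Definition fiber_dense (N : set nat) (D E : set (nat -> bool)) : Prop :=
  forall d t m, D d -> exists2 e, E e &
    (forall k, N k -> e k = d k) /\ (forall k, k < m -> ~ N k -> e k = t k).

(** This is the only use of finiteness in the back-and-forth construction: a point
outside a finite set is told apart from it by finitely many bits. *)
Lemma finite_separated (R : relation) d : finite_set R ->
  exists m, forall p, R p -> agree m p.1 d -> p.1 = d.
Proof.
move=> finR.
have /choice[f fP] : forall p : (nat -> bool) * (nat -> bool),
    exists m, agree m p.1 d -> p.1 = d.
  move=> p; have [->|/agree_neq[m pm]] := pselect (p.1 = d); first by exists 0.
  by exists m => /pm.
have [b bP] := finite_set_bounded f finR.
by exists b => p Rp pd; apply: fP; apply: agree_le pd; exact/ltnW/bP.
Qed.

(** One step forth.  The extension of [R] sends [d] to some [w] at the right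
distances from the points already matched, but possibly outside [E]; any point of
[E] in the fiber of [d] that is close enough to [w] has the same distances. *)
Lemma fiberwise_isometry_extend N D E R d :
    fiber_dense N D E -> finite_set R -> fiberwise_isometry N D E R -> D d ->
  exists e, fiberwise_isometry N D E (R `|` [set (d, e)]).
Proof.
move=> DE finR gR Dd; have [iR RDE fixR] := gR.
have [m mP] := finite_separated d finR.
have [[p Rp pd]|nRd] := pselect (exists2 p, R p & p.1 = d).
  exists p.2; rewrite -pd -surjective_pairing (_ : R `|` _ = R) //.
  by apply/seteqP; split=> [q [|->]|q]; [| |left].
pose w := extension R d.
have [e Ee [eN ew]] := DE d w m Dd.
have e_w : agree m e w.
  move=> k km; have [Nk|Nk] := pselect (N k); last exact: ew.
  by rewrite eN // /w extension_fix // => p Rp; apply: fixR.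
have step p : R p -> forall k, agree k p.1 d <-> agree k p.2 e.
  move=> Rp k; have pw j : agree j p.2 w <-> agree j p.1 d.
    by rewrite -(extension_graph iR Rp) extension_agree.
  have [km|mk] := leqP k m.
    have ekw := agree_le km e_w.
    split=> [/pw pk|pk]; first exact: agree_trans pk (agree_sym ekw).
    by apply/pw; apply: agree_trans pk ekw.
  split=> [/(agree_le (ltnW mk))/(mP _ Rp) pd|/(agree_le (ltnW mk)) pe].
    by case: nRd; exists p.
  case: nRd; exists p => //; apply: mP => //; apply/pw; exact: agree_trans pe e_w.
exists e; split.
- move=> p q [Rp|->] [Rq|->] k //=; first exact: iR; first exact: step.
  by split=> /agree_sym/(step _ Rq)/agree_sym.
- by move=> p [/RDE|->].
- by move=> p k [Rp|->] Nk; [exact: fixR|rewrite /= eN].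
Qed.

Lemma countable_enum (T : Type) (A : set T) : countable A -> A !=set0 ->
  exists f : nat -> T, A = range f.
Proof.
move=> /pfcard_geP[->[]//|[f] _]; exists f; apply/seteqP; split=> [x Ax|x [n _ <-]].
  by have [n _ <-] := 'surj_f Ax; exists n.
by apply: (@funS _ _ _ _ f).
Qed.

(** The step back is the step forth for the converse relation. *)
Lemma back_and_forth N D E : countable D -> D !=set0 -> countable E -> E !=set0 ->
  fiber_dense N D E -> fiber_dense N E D ->
  exists R, [/\ fiberwise_isometry N D E R, forall d, D d -> exists e, R (d, e)
              & forall e, E e -> exists d, R (d, e)].
Proof.
move=> /countable_enum cD /cD[d Dd] /countable_enum cE /cE[e Ee] DE ED.
pose isState R := finite_set R /\ fiberwise_isometry N D E R.
pose state := {R : relation | isState R}.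
have finU (R : relation) p : finite_set R -> finite_set (R `|` [set p]).
  by move=> finR; rewrite finite_setU; split=> //; exact: finite_set1.
have step (nS : nat * state) : exists S' : state,
    [/\ sval nS.2 `<=` sval S', exists y, sval S' (d nS.1, y)
      & exists x, sval S' (x, e nS.1)].
  case: nS => n [R [finR gR]] /=.
  have [|y gR1] := @fiberwise_isometry_extend _ _ _ _ (d n) DE finR gR.
    by rewrite Dd; exists n.
  have /finU finR1 := finR; have {}finR1 := finR1 (d n, y).
  have finC (Q : relation) : finite_set Q -> finite_set (converse Q).
    move=> finQ; suff -> : converse Q = (fun p => (p.2, p.1)) @` Q.
      exact: finite_image.
    apply/seteqP; split=> [[a b] Qab|_ [[a b] Qab <-]] //; by exists (b, a).
  have [|x gR2] := @fiberwise_isometry_extend _ _ _ _ (e n) ED (finC _ finR1)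
    (fiberwise_isometry_converse gR1).
    by rewrite Ee; exists n.
  have finR2 := finC _ (finU _ (e n, x) (finC _ finR1)).
  exists (exist isState _ (conj finR2 (fiberwise_isometry_converse gR2))).
  by split=> /= [[a b] Rab||]; [left; left|exists y; left; right|exists x; right].
(* Stage [n] matches the [n]-th points of both enumerations. *)
have [next nextP] := choice step.
have finR0 : finite_set (set0 : relation) by exact: finite_set0.
have gR0 : fiberwise_isometry N D E set0 by split.
pose S0 : state := exist isState _ (conj finR0 gR0).
pose S := fix S n : state := if n is k.+1 then next (k, S k) else S0.
have S_mono i j : i <= j -> sval (S i) `<=` sval (S j).
  move=> /subnK <-; elim: (j - i) => // k IH p /IH.
  by rewrite addSn /=; have [+ _ _] := nextP (k + i, S (k + i)); exact.
exists (\bigcup_n sval (S n)); split.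
- split=> [p q [i _ Sp] [j _ Sq]|p [i _ Sp]|p k [i _ Sp]].
  + have [_ [iS _ _]] := svalP (S (maxn i j)).
    by apply: iS; [apply: S_mono Sp|apply: S_mono Sq];
      [exact: leq_maxl|exact: leq_maxr].
  + by have [_ [_ + _]] := svalP (S i); exact.
  + by have [_ [_ _]] := svalP (S i); exact.
- move=> x Dx; have [n _ <-] : range d x by rewrite -Dd.
  have [_ [y Sy] _] := nextP (n, S n).
  by exists y, n.+1.
- move=> y Ey; have [n _ <-] : range e y by rewrite -Ee.
  have [_ _ [x Sx]] := nextP (n, S n).
  by exists x, n.+1.
Qed.

Lemma isometry_exists N D E :
    countable D -> D !=set0 -> countable E -> E !=set0 ->
    fiber_dense N D E -> fiber_dense N E D ->
  exists h g : (nat -> bool) -> nat -> bool,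
    [/\ cancel h g, cancel g h,
        (forall m x y, agree m x y -> agree m (h x) (h y)) /\
        (forall m x y, agree m x y -> agree m (g x) (g y)),
        (forall x k, N k -> h x k = x k) /\ (forall x k, N k -> g x k = x k)
      & h @` D = E].
Proof.
move=> cD D0 cE E0 DE ED.
have [R [gR RD RE]] := back_and_forth cD D0 cE E0 DE ED; have [iR RDE fixR] := gR.
exists (extension R), (extension (converse R)); split.
- exact: extensionK.
- by have := extensionK (isometric_converse iR); rewrite converseK.
- by split=> m x y xy; apply/extension_agree.
- by split=> x k Nk; apply: extension_fix => p Rp; [|symmetry];
    apply: (fixR _ _ Rp Nk).
- apply/seteqP; split=> [_ [x Dx <-]|y Ey].
    have [y Rxy] := RD _ Dx; rewrite (extension_graph iR Rxy).
    by have [] := RDE _ Rxy.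
  have [x Rxy] := RE _ Ey; exists x; first by have [] := RDE _ Rxy.
  exact: (extension_graph iR Rxy).
Qed.

(** * Neighbourhoods in the Cantor space *)

Lemma nbhs_bool (b : bool) (A : set bool) : nbhs b A <-> A b.
Proof.
rewrite nbhs_principalE; split=> [/principal_filterP//|Ab]; exact/principal_filterP.
Qed.

Lemma nbhs_agree (T : topologicalType) (f : T -> nat -> bool) (t : T) m :
  (forall k, continuous (fun s => f s k)) -> nbhs t [set s | agree m (f t) (f s)].
Proof.
move=> cf; elim: m => [|m IH]; first by apply: filterS filterT => s _ i.
have : nbhs t [set s | f t m = f s m].
  by apply: (cf m t [set b | f t m = b]); exact/nbhs_bool.
apply: filterS2 IH => s IH ft; exact: agreeS.
Qed.

(** For the direct implication, the filter generated by the cylinders around [x]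
converges to [x] coordinatewise, hence in the product topology. *)
Lemma nbhs_cantorP (x : cantor_space) (A : set cantor_space) :
  nbhs x A <-> exists m, [set y | agree m x y] `<=` A.
Proof.
split=> [|[m mA]]; last first.
  apply: filterS mA _; apply: (@nbhs_agree cantor_space (fun y => y)) => k.
  exact: (@proj_continuous nat (fun=> bool) k).
pose C : set_system cantor_space :=
  [set A | exists m, [set y | agree m x y] `<=` A].
have CF : Filter C.
  split=> [|B1 B2 [m1 B1m] [m2 B2m]|B1 B2 B12 [m B1m]]; first by exists 0.
    exists (maxn m1 m2) => y xy; split; [apply: B1m|apply: B2m].
      by apply: agree_le xy; exact: leq_maxl.
    by apply: agree_le xy; exact: leq_maxr.
  by exists m; exact: subset_trans B12.
suff : C --> x by apply.
apply/cvg_sup => i B [_ [[V oV <-] Vx VB]]; exists i.+1 => y xy; apply: VB => /=.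
by rewrite -xy.
Qed.

(** * The diagonal property of non-meager P-filters *)

(** The form in which both the P-property and non-meagerness are used: a set
[N] of the filter that, cut at infinitely many places [m], falls into the
[m]-th set of a prescribed sequence. *)
Definition diagonalizable (F : set_system nat) : Prop :=
  forall G : nat -> set nat, (forall m, F (G m)) ->
    exists2 N, F N &
      forall k, exists2 m, k <= m & forall j, N j -> m <= j -> G m j.

(** The sets that meet every block from the [K]-th on form a nowhere dense family:
any finite initial segment can be prolonged by zeros beyond a whole block. *)
Lemma nonmeager_misses_blocks (F : set_system nat) (n_ : nat -> nat) :
    ~ meager (cantor_of F) -> (forall k, n_ k < n_ k.+1) ->
  exists2 Z, F Z &
    forall K, exists2 k, K <= k & forall j, Z j -> n_ k <= j -> n_ k.+1 <= j.
Proof.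
move=> nmF n_incr; apply: contrapT => nZ; apply: nmF.
pose G K : set cantor_space :=
  [set z | forall k, K <= k -> exists j, [/\ z j, n_ k <= j & j < n_ k.+1]].
have n_ge k : k <= n_ k by elim: k => // k IH; apply: leq_ltn_trans (n_incr k).
exists G => [K|z Fz]; last first.
  apply: contrapT => nG; apply: nZ; exists [set k | z k] => // K.
  apply: contrapT => nK; apply: nG; exists K => // k Kk.
  apply: contrapT => nj; apply: nK; exists k => // j zj nkj.
  by rewrite leqNgt; apply/negP => jn; apply: nj; exists j.
apply/seteqP; split=> // x /nbhs_cantorP[m mG].
(* [y] prolongs by zeros the first [m] bits of [x]. *)
pose y : cantor_space := fun k => if k < m then x k else false.
have /mG/= : agree m x y by move=> i im; rewrite /y im.
pose k := maxn K m.
move=> /(_ [set z | agree (n_ k.+1) y z]) [].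
  by apply/nbhs_cantorP; exists (n_ k.+1).
move=> z [/(_ k (leq_maxl _ _)) [j [zj nkj jn]] /(_ j jn)].
rewrite zj /y ltnNge (leq_trans _ nkj) //.
exact: leq_trans (leq_maxr K m) (n_ge k).
Qed.

Lemma P_filter_diagonalizable (F : set_system nat) :
  P_filter F -> ~ meager (cantor_of F) -> diagonalizable F.
Proof.
move=> [PF PP] nmF G FG; have [Y FY YG] := PP G FG.
have /choice[f fP] : forall m, exists b, forall j, Y j -> b <= j -> G m j.
  move=> m; have [b bP] := finite_set_bounded id (YG m).
  exists b => j Yj; rewrite leqNgt => /negP jb; apply: contrapT => nG.
  by apply: jb; apply: bP.
pose n_ := fix n_ k := if k is k'.+1 then maxn (n_ k').+1 (f (n_ k')) else 0.
have n_incr k : n_ k < n_ k.+1 by exact: leq_maxl.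
have n_ge k : k <= n_ k by elim: k => // k IH; apply: leq_ltn_trans (n_incr k).
have [Z FZ ZP] := nonmeager_misses_blocks nmF n_incr.
exists (Y `&` Z) => [|K]; first exact: filterI.
have [k Kk kP] := ZP K; exists (n_ k) => [|j [Yj Zj] /(kP _ Zj) kj].
  exact: leq_trans (n_ge k).
by apply: fP => //; apply: leq_trans kj; exact: leq_maxr.
Qed.

(** * The countable power of a filter *)

Section PowerFilter.
Variables (code : nat * nat -> nat) (decode : nat -> nat * nat).
Hypotheses (codeK : cancel code decode) (decodeK : cancel decode code).

Definition power_filter (F : set_system nat) : set_system nat :=
  [set A | forall n, F [set j | A (code (n, j))]].

Lemma power_filter_filter (F : set_system nat) :
  Filter F -> Filter (power_filter F).
Proof.
move=> FF; split=> [n|A B FA FB n|A B AB FA n]; first exact: filterT.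
  exact: filterI (FA n) (FB n).
by apply: filterS (FA n) => j; exact: AB.
Qed.

Lemma frechet_power (F : set_system nat) :
  frechet `<=` F -> frechet `<=` power_filter F.
Proof.
move=> ext A finA n; apply: ext; rewrite /frechet /=.
apply: (finite_preimage (B := ~` A) (f := fun j => code (n, j))) => //.
by move=> i j _ _ /(can_inj codeK) [].
Qed.

(** The diagonal property of [F] is applied to the intersections of the sections of
index at most [c_ m] of [G (c_ m)], where [c_ m >= m] bounds the codes of the
pairs below [m].  The resulting [M] is used in every section, after two
corrections, which remove from the [n]-th section the points up to [n] and those
escaping from the sections of [G i] for some [i < n].  A pair [(n, j)] with code at
least [c_ m] is then in [G (c_ m)] in every case: by the second correction if
[n > c_ m], and by the choice of [M] if [n <= c_ m] and [j >= m]; the case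
[j < m] does not occur, as it would imply [n < j < m] and a code below [c_ m]. *)
Lemma diagonalizable_power (F : set_system nat) :
  Filter F -> frechet `<=` F -> diagonalizable F -> diagonalizable (power_filter F).
Proof.
move=> FF ext dF G FG.
have /choice[c cP] : forall m, exists b, forall p : nat * nat,
    p.1 < m -> p.2 < m -> code p < b.
  move=> m; have finm := finite_setX (finite_II m) (finite_II m).
  have [b bP] := finite_set_bounded code finm.
  by exists b => p p1 p2; apply: bP.
pose c_ m := maxn m (c m).
pose H m : set nat :=
  [set j | forall n : 'I_(c_ m).+1, G (c_ m) (code (n : nat, j))].
have [|M FM MP] := dF H.
  by move=> m; apply: filter_forall => n; exact: FG.
(* [n < j] and [i < n] are the two corrections. *)
pose N := [set k | let: (n, j) := decode k in
  [/\ M j, n < j & forall i : 'I_n, G i k]].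
exists N => [n|k].
  rewrite /N /=; under eq_set do rewrite codeK /=.
  have F1 : F [set j | n < j].
    apply: ext; apply: sub_finite_set (finite_II n.+1) => j /= /negP.
    by rewrite -leqNgt.
  have F2 : F [set j | forall i : 'I_n, G i (code (n, j))].
    by apply: filter_forall => i; exact: FG.
  by apply: filterS3 FM F1 F2 => j.
have [m km mP] := MP k; exists (c_ m) => [|q].
  exact: leq_trans km (leq_maxl _ _).
rewrite /N /= -{2 3 4}[q]decodeK; case: (decode q) => n j [Mj nj NG] cq.
have [cn|nc] := ltnP (c_ m) n; first exact: (NG (Ordinal cn)).
have [mj|jm] := leqP m j.
  by apply: (mP _ Mj mj (Ordinal (_ : n < _))); rewrite ltnS.
have := cP m (n, j) (ltn_trans nj jm) jm.
by rewrite ltnNge (leq_trans _ cq) // leq_maxr.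
Qed.

End PowerFilter.

(** * Finding the coordinates to keep *)

(** Below [m] the word [u] copies [d] on [N] and [t] off [N]; beyond [m] both [d]
and the point chosen for [u] are [true] on [N], since [N] lies in [G m] there. *)
Lemma fiber_dense_of_diagonal (G : nat -> set nat) (N : set nat)
    (D E : set (nat -> bool)) (e : seq bool -> nat -> bool) :
    (forall k, exists2 m, k <= m & forall j, N j -> m <= j -> G m j) ->
    (forall d, D d -> exists r, forall m j, r <= m -> G m j -> d j) ->
    (forall u, E (e u)) ->
    (forall u k, k < size u -> e u k = nth false u k) ->
    (forall u j, G (size u) j -> e u j) ->
  fiber_dense N D E.
Proof.
move=> NG DG Ee e_u Ge d t m0 Dd; have [r rP] := DG d Dd.
have [m + mP] := NG (maxn r m0); rewrite geq_max => /andP[rm m0m].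
pose u := mkseq (fun k => if `[< N k >] then d k else t k) m.
have su : size u = m by rewrite size_mkseq.
have eu k : k < m -> e u k = if `[< N k >] then d k else t k.
  by move=> km; rewrite e_u ?su // nth_mkseq.
exists (e u) => //; split=> k.
  move=> Nk; have [mk|/eu->] := leqP m k; last by case: asboolP.
  have Gk := mP _ Nk mk; rewrite (rP m) //; apply: Ge; by rewrite su.
by move=> km Nk; rewrite eu ?(leq_trans km) //; case: asboolP.
Qed.

(** All the points that enter into [G m] belong to the filter and there are finitely
many of them, so [G m] belongs to the filter as well. *)
Lemma exists_fiber_dense (F : set_system nat) (D E : set (nat -> bool)) :
    Filter F -> diagonalizable F ->
    countable D -> D !=set0 -> countable E -> E !=set0 ->
    D `<=` cantor_of F -> E `<=` cantor_of F ->
    (forall t m, exists2 d, D d & agree m t d) ->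
    (forall t m, exists2 e, E e & agree m t e) ->
  exists N, [/\ F N, fiber_dense N D E & fiber_dense N E D].
Proof.
move=> FF dF /countable_enum cD /cD[d Dd] /countable_enum cE /cE[e Ee].
move=> DF EF Ddense Edense.
have choose (A : set (nat -> bool)) : (forall t m, exists2 d, A d & agree m t d) ->
    exists f : seq bool -> nat -> bool, (forall u, A (f u)) /\
      forall u k, k < size u -> f u k = nth false u k.
  move=> Adense; have /choice[f fP] : forall u : seq bool, exists x,
    A x /\ agree (size u) (nth false u) x.
    by move=> u; have [x] := Adense (nth false u) (size u); exists x.
  by exists f; split=> [u|u k ku]; have [//+ fu] := fP u; rewrite fu.
have [f [Df f_u]] := choose _ Ddense; have [g [Eg g_u]] := choose _ Edense.
pose G m : set nat := [set j |
  [/\ forall r : 'I_m.+1, d r j, forall r : 'I_m.+1, e r j,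
      forall u : m.-tuple bool, f u j & forall u : m.-tuple bool, g u j]].
have FG m : F (G m).
  have F1 : F [set j | forall r : 'I_m.+1, d r j].
    by apply: filter_forall => r; apply: DF; rewrite Dd; exists r.
  have F2 : F [set j | forall r : 'I_m.+1, e r j].
    by apply: filter_forall => r; apply: EF; rewrite Ee; exists r.
  have F3 : F [set j | forall u : m.-tuple bool, f u j].
    by apply: filter_forall => u; exact/DF/Df.
  have F4 : F [set j | forall u : m.-tuple bool, g u j].
    by apply: filter_forall => u; exact/EF/Eg.
  by apply: filterS2 (filterI F1 F2) (filterI F3 F4) => j [? ?] [].
have [N FN NG] := dF G FG; exists N; split=> //.
  apply: (fiber_dense_of_diagonal NG _ Eg g_u)
    => [x|u j [_ _ _ /(_ (in_tuple u))]//].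
  by rewrite Dd => -[r _ <-]; exists r => m j rm [/(_ (inord r))]; rewrite inordK.
apply: (fiber_dense_of_diagonal NG _ Df f_u) => [x|u j [_ _ /(_ (in_tuple u))]//].
by rewrite Ee => -[r _ <-]; exists r => m j rm [_ /(_ (inord r))]; rewrite inordK.
Qed.

(** * Countable dense homogeneity of the space of a filter *)

Section FilterSpace.
Variable F : set_system nat.

Definition chi (x : filter_space F) : nat -> bool :=
  val (x : set_type (cantor_of F)).

Definition of_chi (x : nat -> bool) (Fx : cantor_of F x) : filter_space F :=
  SigSub (mem_set Fx).

Lemma cantor_of_chi x : cantor_of F (chi x).
Proof. exact: set_valP. Qed.

Lemma chi_inj : injective chi.
Proof. exact: val_inj. Qed.

Lemma nbhs_filter_spaceP (x : filter_space F) (A : set (filter_space F)) :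
  nbhs x A <-> exists m, forall y, agree m (chi x) (chi y) -> A y.
Proof.
split.
  move=> [_ [[V oV <-] Vx VA]].
  have /nbhs_cantorP[m mV] : nbhs (chi x : cantor_space) V by exact: open_nbhs_nbhs.
  by exists m => y xy; apply: VA; apply: mV.
move=> [m mA]; have cx : continuous (chi : _ -> cantor_space).
  exact: (@initial_continuous _ _ (@set_val _ (cantor_of F))).
apply: filterS mA _; apply: (cx x [set y | agree m (chi x) y]).
by apply/nbhs_cantorP; exists m.
Qed.

Lemma chi_continuous k : continuous (fun x => chi x k).
Proof.
move=> x A /nbhs_bool Ax; apply/nbhs_filter_spaceP; exists k.+1 => y xy /=.
by rewrite -xy.
Qed.

Lemma continuous_chi (T : topologicalType) (f : T -> filter_space F) :
  (forall k, continuous (fun t => chi (f t) k)) -> continuous f.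
Proof.
move=> cf t A /nbhs_filter_spaceP[m mA]; apply: filterS (nbhs_agree t m cf).
by move=> s; exact: mA.
Qed.

Hypotheses (FF : Filter F) (ext : frechet `<=` F).

Lemma cofinite_cantor_of m (x : nat -> bool) :
  (forall k, m <= k -> x k) -> cantor_of F x.
Proof.
move=> xm; apply: ext; apply: sub_finite_set (finite_II m) => k /= xk.
by rewrite ltnNge; apply/negP => /xm.
Qed.

Lemma dense_cylinderP (D : set (filter_space F)) :
  dense D <-> forall t m, exists2 d, D d & agree m t (chi d).
Proof.
split=> [dD t m|Dd O [x Ox] oO].
  have Ft : cantor_of F (fun k => if k < m then t k else true).
    by apply: (@cofinite_cantor_of m) => k; rewrite ltnNge => ->.
  have [||d [td Dd]] := dD [set y | agree m t (chi y)].
  - by exists (of_chi Ft) => k km; rewrite /chi /= km.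
  - rewrite openE => y ty; apply/nbhs_filter_spaceP; exists m => z.
    exact: agree_trans.
  - by exists d.
have /nbhs_filter_spaceP[m mO] : nbhs x O by exact: open_nbhs_nbhs.
by have [d Dd' xd] := Dd (chi x) m; exists d; split=> //; apply: mO.
Qed.

Lemma separable_filter_space : separable (filter_space F).
Proof.
have Fu (u : seq bool) : cantor_of F (nth true u).
  by apply: (@cofinite_cantor_of (size u)) => k uk; rewrite nth_default.
exists (range (fun u => of_chi (Fu u))).
  exact: sub_countable (card_image_le _ _) (countableP _).
apply/dense_cylinderP => t m; exists (of_chi (Fu (mkseq t m))).
  by exists (mkseq t m).
by move=> k km; rewrite /chi /= nth_mkseq.
Qed.

Lemma filter_space_cdh :
  diagonalizable F -> countable_dense_homogeneous (filter_space F).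
Proof.
move=> dF; split=> [|D E cD dD cE dE]; first exact: separable_filter_space.
have countable_chi (A : set (filter_space F)) : countable A -> countable (chi @` A).
  by move=> cA; apply: sub_countable cA; exact: card_image_le.
have dense_chi (A : set (filter_space F)) : dense A ->
    forall t m, exists2 d, (chi @` A) d & agree m t d.
  move=> /dense_cylinderP dA t m; have [d Ad td] := dA t m.
  by exists (chi d) => //; exists d.
have nonempty_chi (A : set (filter_space F)) : dense A -> chi @` A !=set0.
  by move=> /dense_chi /(_ xpredT 0) [d Ad _]; exists d.
have sub_chi (A : set (filter_space F)) : chi @` A `<=` cantor_of F.
  by move=> _ [x _ <-]; exact: cantor_of_chi.
have [N [FN DE ED]] := exists_fiber_dense FF dF
  (countable_chi _ cD) (nonempty_chi _ dD)
  (countable_chi _ cE) (nonempty_chi _ dE) (@sub_chi D) (@sub_chi E)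
  (dense_chi _ dD) (dense_chi _ dE).
have [h [g [hK gK [h_agree g_agree] [hN gN] hDE]]] :=
  isometry_exists (countable_chi _ cD) (nonempty_chi _ dD)
    (countable_chi _ cE) (nonempty_chi _ dE) DE ED.
have FP (f : (nat -> bool) -> nat -> bool) : (forall x k, N k -> f x k = x k) ->
    forall x, cantor_of F (f (chi x)).
  by move=> fN x; apply: filterS2 FN (cantor_of_chi x) => k /= Nk xk; rewrite fN.
have lift_continuous f (fN : forall x k, N k -> f x k = x k) :
    (forall m x y, agree m x y -> agree m (f x) (f y)) ->
    continuous (fun x => of_chi (FP f fN x)).
  move=> f_agree x A /nbhs_filter_spaceP[m mA]; apply/nbhs_filter_spaceP.
  by exists m => y xy; apply: mA; exact: f_agree.
exists (fun x => of_chi (FP h hN x)).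
  exists (fun x => of_chi (FP g gN x)); split.
  - by move=> x; apply: chi_inj; exact: hK.
  - by move=> x; apply: chi_inj; exact: gK.
  - exact: lift_continuous.
  - exact: lift_continuous.
apply/seteqP; split=> [_ [x Dx <-]|y Ey].
  have : (chi @` E) (h (chi x)) by rewrite -hDE; exists (chi x) => //; exists x.
  by move=> [y Ey yx]; rewrite (_ : of_chi _ = y) //; exact: chi_inj.
have : (h @` (chi @` D)) (chi y) by rewrite hDE; exists y.
by move=> [_ [x Dx <-] xy]; exists x => //; exact: chi_inj.
Qed.

End FilterSpace.

Lemma dense_image (T U : topologicalType) (f : T -> U) (g : U -> T) (D : set T) :
  cancel g f -> continuous f -> dense D -> dense (f @` D).
Proof.
move=> gK cf dD O [u Ou] oO.
have [||t [Oft Dt]] := dD (f @^-1` O).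
- by exists (g u); rewrite /preimage /= gK.
- by apply: open_comp => // x _; exact: cf.
- by exists (f t); split=> //; exists t.
Qed.

Lemma cdh_transfer (T U : topologicalType) (f : T -> U) (g : U -> T) :
    cancel f g -> cancel g f -> continuous f -> continuous g ->
  countable_dense_homogeneous U -> countable_dense_homogeneous T.
Proof.
move=> fK gK cf cg [[D cD dD] hU]; split.
  exists (g @` D); last exact: dense_image dD.
  by apply: sub_countable cD; exact: card_image_le.
move=> A B cA dA cB dB.
have countable_f (C : set T) : countable C -> countable (f @` C).
  by move=> cC; apply: sub_countable cC; exact: card_image_le.
have [h [k [hK kK ch ck]] hAB] := hU _ _ (countable_f _ cA) (dense_image gK cf dA)
  (countable_f _ cB) (dense_image gK cf dB).
exists (g \o h \o f).
  exists (g \o k \o f); split=> [x|x||] /=; rewrite ?gK ?hK ?kK ?fK //.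
    move=> x; apply: continuous_comp; first exact: cf.
    by apply: continuous_comp; [exact: ch|exact: cg].
  move=> x; apply: continuous_comp; first exact: cf.
    by apply: continuous_comp; [exact: ck|exact: cg].
rewrite -(image_comp f) -(image_comp h) hAB image_comp.
by rewrite (_ : g \o f = id) ?image_id //; exact/funext.
Qed.

Lemma continuous_prod (T : topologicalType) (I : Type) (K : I -> topologicalType)
    (f : T -> prod_topology K) :
  (forall i, continuous (fun t => f t i)) -> continuous f.
Proof.
move=> cf t; apply/cvg_sup => i.
exact: (@continuous_comp_initial _ _ _ (fun f : forall i, K i => f i) f (cf i) t).
Qed.

(** Over a bijective coding of pairs, currying is a homeomorphism from the space
of [power_filter code F] onto the power of the space of [F]. *)
Lemma filter_power_cdh (F : set_system nat) :
  Filter F -> frechet `<=` F -> diagonalizable F ->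
  countable_dense_homogeneous (filter_power F).
Proof.
move=> FF ext dF.
have /card_set_bijP[code] := card_nat2; rewrite setTT_bijective.
case=> decode codeK decodeK.
pose G := power_filter code F.
have Gphi (z : filter_power F) :
    cantor_of G (fun k => chi (z (decode k).1) (decode k).2).
  move=> n /=; under eq_set do rewrite codeK /=.
  exact: cantor_of_chi.
have Fpsi (w : filter_space G) n : cantor_of F (fun j => chi w (code (n, j))).
  exact: (cantor_of_chi w n).
pose phi z : filter_space G := of_chi (Gphi z).
pose psi w : filter_power F := fun n => of_chi (Fpsi w n).
apply: (@cdh_transfer _ _ phi psi).
- by move=> z; apply/functional_extensionality_dep => n; apply: chi_inj;
    apply/funext => j; rewrite /phi /psi /chi /= codeK.
- by move=> w; apply: chi_inj; apply/funext => k;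
    rewrite (_ : chi _ k = chi w (code ((decode k).1, (decode k).2))) //
      -surjective_pairing decodeK.
- apply: continuous_chi => k z.
  apply: (@continuous_comp _ _ _ (fun z : filter_power F => z (decode k).1)
    (fun x => chi x (decode k).2)); last exact: chi_continuous.
  exact: (@proj_continuous nat (fun=> filter_space F)).
- apply: continuous_prod => n; apply: continuous_chi => j; exact: chi_continuous.
apply: filter_space_cdh.
- exact: power_filter_filter.
- exact: frechet_power codeK _ ext.
- exact: diagonalizable_power.
Qed.

Unset Implicit Arguments.

Theorem theorem1p6 (F : set_system nat)
    (Pfil : P_filter F) (nonmeager : ~ meager (cantor_of F))
    (ext : frechet `<=` F) :
  countable_dense_homogeneous (filter_space F) /\
  countable_dense_homogeneous (filter_power F).
Proof.
have dF := P_filter_diagonalizable Pfil nonmeager.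
have [PF _] := Pfil; split; first exact: filter_space_cdh.
exact: filter_power_cdh.
Qed.
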